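(* Let $\mathbb{K}$ be an algebraically closed field of characteristic zero and let $X$ be a degenerate affine toric variety over $\mathbb{K}$ with an acting torus $T$. Then the automorphism group $\mathrm{Aut}(X)$ is not connected.
   Context: A toric variety is a normal irreducible algebraic variety $X$ containing an algebraic torus $T=(\mathbb{K}^\times)^n$ as a dense Zariski-open subset such that the action of $T$ on itself by multiplication extends to a regular action of $T$ on $X$. A toric variety is called non-degenerate if its only invertible regular functions are constants, and degenerate otherwise; $X$ is degenerate if and only if it is a direct product of a toric variety and an algebraic torus of positive dimension. $\mathrm{Aut}(X)$ is the group of regular automorphisms of $X$. For an irreducible affine algebraic variety $S$, a map $S\to\mathrm{Aut}(X)$, $s\mapsto\phi_s$, is called an algebraic family if $S\times X\to X$, $(s,x)\mapsto\phi_s(x)$, is a morphism of algebraic varieties. $\mathrm{Aut}(X)$ is called connected if for every $g\in\mathrm{Aut}(X)$ there is an algebraic family in $\mathrm{Aut}(X)$ containing both $g$ and the identity automorphism. *)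

(* Defs.v *)
From HB Require Import structures.
From mathcomp Require Import all_boot all_order all_algebra.
From mathcomp Require Import boolp classical_sets functions.
From mathcomp Require Import mpoly.

Set Implicit Arguments.
Unset Strict Implicit.
Unset Printing Implicit Defensive.

Import GRing.Theory.
Local Open Scope ring_scope.
Local Open Scope classical_set_scope.

(** Affine varieties are irreducible Zariski-closed subsets of K^n, points of
    K^n being row vectors.  A set [A : set 'rV[K]_n] coerces to the type of
    its points, so a map of varieties is a function [X -> Y] between point
    types, and two such functions are equal iff they agree on every point. *)

Section AffineSets.
Variable K : closedFieldType.

Definition peval n (p : {mpoly K[n]}) (x : 'rV[K]_n) : K :=
  p.@[fun i => x 0 i].

Definition zeros n (F : set {mpoly K[n]}) : set 'rV[K]_n :=
  [set x | forall p, F p -> peval p x = 0].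

Record algSet n := AlgSet {
  algSet_points :> set 'rV[K]_n;
  algSet_closed : exists F, algSet_points = zeros F
}.

Definition irreducible n (X : algSet n) : Prop :=
  X !=set0 /\
  forall Y Z : algSet n, X `<=` Y `|` Z -> X `<=` Y \/ X `<=` Z.

Record affineVariety n := AffineVariety {
  variety_algSet :> algSet n;
  variety_irr : irreducible variety_algSet
}.

Definition coord n (A : set 'rV[K]_n) (j : 'I_n) (x : A) : K := val x 0 j.

Definition regular n (X : algSet n) (f : X -> K) : Prop :=
  exists p : {mpoly K[n]}, forall x : X, f x = peval p (val x).

Definition regular_map n m (X : algSet n) (Y : algSet m) (f : X -> Y) : Prop :=
  forall j : 'I_m, regular (fun x => coord j (f x)).

(** On a subset which need not be closed, a function is regular when it is
    locally a quotient of polynomials. *)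
Definition locally_regular n (U : set 'rV[K]_n) (f : U -> K) : Prop :=
  forall x : U, exists a b : {mpoly K[n]},
    peval b (val x) != 0 /\
    forall y : U, peval b (val y) != 0 ->
      f y = peval a (val y) / peval b (val y).

Definition open_in n (X : algSet n) (U : set 'rV[K]_n) : Prop :=
  exists Z : algSet n, U = X `\` Z.

Definition dense_in n (X : algSet n) (U : set 'rV[K]_n) : Prop :=
  U `<=` X /\ forall Z : algSet n, U `<=` Z -> X `<=` Z.

Definition image_points n m (Y : algSet n) (X : algSet m) (f : Y -> X) :
  set 'rV[K]_m := range (fun y => val (f y)).

(** [f] is an isomorphism of varieties from [Y] onto an open subset of [X]. *)
Definition open_embedding n m (Y : algSet n) (X : algSet m) (f : Y -> X) :
    Prop :=
  [/\ regular_map f,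
      open_in X (image_points f)
    & exists g : image_points f -> Y,
        (forall y u, val u = val (f y) -> g u = y) /\
        forall j : 'I_n, locally_regular (fun u => coord j (g u))].

Section Product.
Variables (r m : nat) (S : algSet r) (X : algSet m).

Definition prod_points : set 'rV[K]_(r + m) :=
  [set z | algSet_points S (lsubmx z) /\ algSet_points X (rsubmx z)].

Lemma prod_closed : exists F, prod_points = zeros F.
Proof.
have [F SF] := algSet_closed S; have [G XG] := algSet_closed X.
pose lft (p : {mpoly K[r]}) : {mpoly K[r + m]} :=
  p \mPo [tuple 'X_(lshift m i) | i < r].
pose rgt (p : {mpoly K[m]}) : {mpoly K[r + m]} :=
  p \mPo [tuple 'X_(rshift r i) | i < m].
have lftE p z : peval (lft p) z = peval p (lsubmx z).
  rewrite /peval /lft comp_mpoly_meval; apply: meval_eq => i.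
  by rewrite tnth_map tnth_ord_tuple mevalXU mxE.
have rgtE p z : peval (rgt p) z = peval p (rsubmx z).
  rewrite /peval /rgt comp_mpoly_meval; apply: meval_eq => i.
  by rewrite tnth_map tnth_ord_tuple mevalXU mxE.
exists (lft @` F `|` rgt @` G); apply/seteqP; split=> z.
  rewrite /prod_points /= SF XG => -[Sz Xz] _ [] [p Hp <-].
    by rewrite lftE; apply: Sz.
  by rewrite rgtE; apply: Xz.
rewrite /prod_points /= SF XG => H; split=> p Hp.
  by rewrite -lftE; apply: H; left; exists p.
by rewrite -rgtE; apply: H; right; exists p.
Qed.

Definition prodA : algSet (r + m) := AlgSet prod_closed.

Definition prod_fst (z : prodA) : S :=
  SigSub (mem_set (proj1 (set_valP z))).

Definition prod_snd (z : prodA) : X :=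
  SigSub (mem_set (proj2 (set_valP z))).

End Product.

(** A map [S -> X -> Y] which is a morphism on the product [S * X]. *)
Definition regular_map2 r m k (S : algSet r) (X : algSet m) (Y : algSet k)
    (f : S -> X -> Y) : Prop :=
  regular_map (fun z : prodA S X => f (prod_fst z) (prod_snd z)).

(** The torus (K \ {0})^n is realized as the closed subset of K^(n + n) whose
    points are the (t, u) with t_i u_i = 1; its regular functions are thus
    the Laurent polynomials in t. *)
Section Torus.
Variable n : nat.

Definition torus_points : set 'rV[K]_(n + n) :=
  [set z | forall i : 'I_n, z 0 (lshift n i) * z 0 (rshift n i) = 1].

Lemma torus_closed : exists F, torus_points = zeros F.
Proof.
exists (range (fun i : 'I_n =>
  'X_(lshift n i) * 'X_(rshift n i) - 1 : {mpoly K[n + n]})).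
have E i z : peval ('X_(lshift n i) * 'X_(rshift n i) - 1) z =
    z 0 (lshift n i) * z 0 (rshift n i) - 1.
  by rewrite /peval mevalB mevalM !mevalXU meval1.
apply/seteqP; split=> z /= Hz.
  by move=> _ [i _ <-]; rewrite E Hz subrr.
by move=> i; apply/eqP; rewrite -subr_eq0 -E; apply/eqP/Hz; exists i.
Qed.

Definition torus : algSet (n + n) := AlgSet torus_closed.

Lemma torus_one_subproof : torus_points (const_mx 1).
Proof. by move=> i; rewrite !mxE mulr1. Qed.

Definition torus_one : torus := SigSub (mem_set torus_one_subproof).

Lemma torus_mul_subproof (s t : torus) :
  torus_points (map2_mx *%R (val s) (val t)).
Proof.
move=> i; rewrite !mxE mulrACA.
by rewrite (set_valP s i) (set_valP t i) mulr1.
Qed.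

Definition torus_mul (s t : torus) : torus :=
  SigSub (mem_set (torus_mul_subproof s t)).

End Torus.

End AffineSets.

Section CoordinateRing.
Variables (K : closedFieldType) (n : nat).

Definition regular_pred (X : affineVariety K n) : {pred (X -> K)} :=
  fun f => `[< regular f >].
Arguments regular_pred : clear implicits.

Lemma regular_subring (X : affineVariety K n) :
  subring_closed (regular_pred X).
Proof.
split=> [|f g /asboolP[p fp] /asboolP[q gq]|f g /asboolP[p fp] /asboolP[q gq]];
  apply/asboolP.
- by exists 1 => x; rewrite /peval meval1.
- by exists (p - q) => x; rewrite /peval mevalB -/(peval _ _) -fp -/(peval _ _) -gq.
- by exists (p * q) => x; rewrite /peval mevalM -/(peval _ _) -fp -/(peval _ _) -gq.
Qed.

Record regfun (X : affineVariety K n) := RegFun {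
  regfun_val :> X -> K;
  _ : regfun_val \in regular_pred X
}.

Variable X : affineVariety K n.

HB.instance Definition _ := [isSub for @regfun_val X].
HB.instance Definition _ := [Choice of regfun X by <:].
HB.instance Definition _ := 
  GRing.SubChoice_isSubComPzRing.Build (X -> K) (regular_pred X) (regfun X)
    (regular_subring X).

Lemma regfunP (f : regfun X) :
  exists p : {mpoly K[n]}, forall x : X, f x = peval p (val x).
Proof. by have /asboolP := valP f. Qed.

Lemma regfunM (f g : regfun X) (x : X) : (f * g) x = f x * g x.
Proof. by []. Qed.

Lemma regfun_neq0 : (1 : regfun X) != 0.
Proof.
apply/eqP => H; have [[x Xx] _] := variety_irr X.
have := congr1 (fun f : regfun X => f (SigSub (mem_set Xx))) H.
by move/eqP; rewrite (oner_eq0 K).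
Qed.

HB.instance Definition _ := GRing.PzSemiRing_isNonZero.Build (regfun X) regfun_neq0.

Definition regfun_unit : {pred regfun X} :=
  fun f => `[< exists g : regfun X, g * f = 1 >].

Definition regfun_inv (f : regfun X) : regfun X :=
  if pselect (exists g : regfun X, g * f = 1) is left e
  then projT1 (cid e) else f.

Lemma regfun_mulVf : {in regfun_unit, left_inverse 1 regfun_inv *%R}.
Proof.
move=> f /asboolP e; rewrite /regfun_inv.
by case: pselect => // e'; case: cid.
Qed.

Lemma regfun_unitP (f g : regfun X) : g * f = 1 -> regfun_unit f.
Proof. by move=> e; apply/asboolP; exists g. Qed.

Lemma regfun_inv_out : {in [predC regfun_unit], regfun_inv =1 id}.
Proof.
move=> f /negP H; rewrite /regfun_inv; case: pselect => // e.
by case: H; apply/asboolP.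
Qed.

HB.instance Definition _ := GRing.ComNzRing_hasMulInverse.Build (regfun X)
  regfun_mulVf regfun_unitP regfun_inv_out.

Lemma regfun_integral (f g : regfun X) : f * g = 0 -> (f == 0) || (g == 0).
Proof.
move=> fg0; have [_ irr] := variety_irr X; have [p fp] := regfunP f; have [q gq] := regfunP g.
pose Z (p : {mpoly K[n]}) : algSet K n :=
  AlgSet (ex_intro _ [set p] (erefl (zeros [set p]))).
have HZ (h : regfun X) s : (forall x : X, h x = peval s (val x)) ->
    X `<=` Z s -> h == 0.
  move=> hs XZ; apply/eqP/val_inj/funext => x /=.
  by rewrite hs; apply: (XZ _ (set_valP x)).
have [|H|H] := irr (Z p) (Z q); last 2 first.
- by rewrite (HZ _ _ fp H).
- by rewrite (HZ _ _ gq H) orbT.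
move=> x Xx; pose x' : X := SigSub (mem_set Xx).
have : f x' * g x' = 0 by rewrite -regfunM fg0.
rewrite fp gq => /eqP; rewrite mulf_eq0 => /orP[]/eqP H.
  by left=> _ ->.
by right=> _ ->.
Qed.

HB.instance Definition _ :=
  GRing.ComUnitRing_isIntegral.Build (regfun X) regfun_integral.

End CoordinateRing.

Definition integrally_closed (R : idomainType) : Prop :=
  forall z : {fraction R}, integralOver (@tofrac R) z ->
    exists a : R, z = tofrac a.

Section ToricVarieties.
Variable K : closedFieldType.

Definition normal n (X : affineVariety K n) : Prop :=
  integrally_closed (regfun X).

(** An affine toric variety in K^m with acting torus (K \ {0})^n, the torus being
    identified with an open subset of the variety by [toric_emb]. *)
Record affineToricVariety n m := AffineToricVariety {
  toric_variety :> affineVariety K m;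
  toric_normal : normal toric_variety;
  toric_emb : torus K n -> toric_variety;
  toric_emb_open : open_embedding toric_emb;
  toric_emb_dense : dense_in toric_variety (image_points toric_emb);
  toric_act : torus K n -> toric_variety -> toric_variety;
  toric_act_regular : regular_map2 toric_act;
  toric_act1 : forall x, toric_act (torus_one K n) x = x;
  toric_actM : forall s t x,
    toric_act (torus_mul s t) x = toric_act s (toric_act t x);
  toric_act_emb : forall s t,
    toric_act s (toric_emb t) = toric_emb (torus_mul s t)
}.

Definition nondegenerate n (X : affineVariety K n) : Prop :=
  forall f : regfun X, f \is a GRing.unit ->
    exists c : K, forall x : X, f x = c.

Definition degenerate n (X : affineVariety K n) : Prop := ~ nondegenerate X.

Definition automorphism n (X : affineVariety K n) (g : X -> X) : Prop :=
  regular_map g /\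
  exists h : X -> X, [/\ regular_map h, cancel g h & cancel h g].

Definition algebraic_family n (X : affineVariety K n) r (S : affineVariety K r)
    (phi : S -> X -> X) : Prop :=
  (forall s, automorphism (phi s)) /\ regular_map2 phi.

Definition Aut_connected n (X : affineVariety K n) : Prop :=
  forall g : X -> X, automorphism g ->
    exists (r : nat) (S : affineVariety K r) (phi : S -> X -> X),
      [/\ algebraic_family phi,
          exists s, phi s = g
        & exists s, phi s = id].

End ToricVarieties.

(* Main.v *)
(** A unit f on X restricts to the torus T as a scalar multiple of a character,
    because a Laurent polynomial with two monomials has a zero on T (K is
    algebraically closed).  If X is degenerate there is thus a character
    k u <> 0, with u primitive, that is a unit on X, and by normality its k-th
    root u is one as well.  Choose a cocharacter lam with <lam, u> = 1.  Then
    r(x) = lam(u(x))^(-2) . x is an involution of X with u o r = u^-1.  In an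
    algebraic family phi over an irreducible base S, u(phi_s(t)) is a unit on
    S x T, hence a function of s times a fixed character of T.  So r and the
    identity cannot belong to the same family. *)

Require Import Defs.
From mathcomp Require Import all_boot all_order all_algebra.
From mathcomp Require Import boolp classical_sets functions mpoly.

Set Implicit Arguments.
Unset Strict Implicit.
Unset Printing Implicit Defensive.

Import Order.TTheory GRing.Theory Num.Theory.
Local Open Scope ring_scope.
Local Open Scope classical_set_scope.

(** * Arithmetic of digits and of integer vectors *)

Lemma digits_inj (B n : nat) (a b : 'I_n -> nat) :
  (forall i, (a i < B)%N) -> (forall i, (b i < B)%N) ->
  (\sum_i a i * B ^ i = \sum_i b i * B ^ i)%N -> forall i, a i = b i.
Proof.
elim: n a b => [|n IHn] a b aB bB; first by move=> _ [].
have B_gt0 : (0 < B)%N by apply: leq_ltn_trans (aB ord0).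
have shift (c : 'I_n.+1 -> nat) : (\sum_i c i * B ^ i =
    (\sum_(i < n) c (lift ord0 i) * B ^ i) * B + c ord0)%N.
  rewrite big_ord_recl muln1 addnC big_distrl /=; congr (_ + _)%N.
  by apply: eq_bigr => i _; rewrite expnSr mulnA.
rewrite !shift => E.
have Emod := congr1 (modn^~ B) E; have Ediv := congr1 (divn^~ B) E.
rewrite /= !modnMDl !modn_small // in Emod.
rewrite /= !divnMDl // !divn_small // !addn0 in Ediv.
move=> i; case: (unliftP ord0 i) => [j ->|->] //.
exact: (IHn (fun j => a (lift ord0 j)) (fun j => b (lift ord0 j))).
Qed.

(** The ideal of the integers generated by the entries of [u] is principal. Its least positive
    element [k] divides every entry, and the quotients form a primitive vector [v]. *)
Lemma bezout_int (n : nat) (u : 'I_n -> int) : (exists i, u i != 0) ->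
  exists (k : nat) (lam v : 'I_n -> int),
    [/\ (0 < k)%N, forall i, u i = k%:Z * v i & \sum_i lam i * v i = 1].
Proof.
move=> [i0 ui0].
(* The index is shifted by one, so that the minimum is taken over the positive combinations only. *)
pose P k := `[< exists lam : 'I_n -> int, \sum_i lam i * u i = k.+1%:Z >].
have exP : exists k, P k.
  exists `|u i0|.-1%N; apply/asboolP.
  exists (fun i => if i == i0 then Num.sg (u i0) else 0).
  rewrite (bigD1 i0) //= eqxx big1 ?addr0.
    by rewrite prednK ?absz_gt0 // abszE normrEsg.
  by move=> i /negPf ->; rewrite mul0r.
case: (ex_minnP exP) => k /asboolP[lam lamE] kmin.
have k0 : k.+1%:Z != 0 by [].
have dv i : (u i %% k.+1%:Z)%Z = 0.
  apply/eqP/negP => /negP r0.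
  have r_ge0 := modz_ge0 (u i) k0; have r_lt := ltz_pmod (u i) (isT : 0 < k.+1%:Z).
  case Er: (u i %% k.+1%:Z)%Z r_ge0 r_lt r0 => [[|r]|] // _ r_lt _.
  suff /kmin : P r by rewrite leqNgt -ltnS -ltz_nat r_lt.
  (* The remainder of [u i] modulo the least combination is again a combination. If it were nonzero,
     it would be a smaller positive one. *)
  apply/asboolP; exists (fun j => (j == i)%:R - (u i %/ k.+1%:Z)%Z * lam j).
  under eq_bigr do rewrite mulrBl -mulrA.
  rewrite sumrB -mulr_sumr lamE (bigD1 i) //= eqxx mul1r big1 ?addr0.
    by rewrite {1}(divz_eq (u i) k.+1%:Z) Er addrC addKr.
  by move=> j /negPf ->; rewrite mul0r.
have uE i : u i = k.+1%:Z * (u i %/ k.+1%:Z)%Z.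
  by rewrite {1}(divz_eq (u i) k.+1%:Z) dv addr0 mulrC.
exists k.+1, lam, (fun i => (u i %/ k.+1%:Z)%Z); split=> //.
apply: (mulfI k0); rewrite mulr1 mulr_sumr -[RHS]lamE.
by apply: eq_bigr => i _; rewrite [in RHS]uE mulrCA.
Qed.

(** * Polynomials without zeros on the torus *)

Section NonvanishingPolynomials.
Variable K : closedFieldType.

(** Split off the full power of ['X] dividing [p]. The cofactor has no root, neither at 0 nor
    elsewhere, so it is constant because [K] is algebraically closed. *)
Lemma poly_monomial (p : {poly K}) : (forall z, z != 0 -> p.[z] != 0) ->
  exists d, forall e, e != d -> p`_e = 0.
Proof.
move=> nz; have p0 : p != 0.
  by apply/eqP => p0; have := nz 1 (oner_neq0 _); rewrite p0 horner0 eqxx.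
have [d [q]] := multiplicity_XsubC p 0; rewrite p0 subr0 /= => q0 pE.
have : size q == 1%N.
  apply: contraT => /closed_rootP[x qx].
  have x0 : x != 0 by apply: contraNneq q0 => <-.
  by have := nz x x0; rewrite pE hornerM (rootP qx) mul0r eqxx.
move=> /size_poly1P[c c0 qE]; exists d => e ed.
by rewrite pE qE coefCM coefXn (negPf ed) mulr0.
Qed.

(* Kronecker substitution [t_i = z ^ (B ^ i)] reduces to one variable. *)
Lemma mpoly_monomial n (p : {mpoly K[n]}) :
  (forall t : 'I_n -> K, (forall i, t i != 0) -> p.@[t] != 0) ->
  exists2 m, p@_m != 0 & forall m', m' != m -> p@_m' = 0.
Proof.
move=> nz; have p0 : p != 0.
  apply/eqP => p0; have := nz (fun=> 1) (fun=> oner_neq0 _).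
  by rewrite p0 meval0 eqxx.
(* [msize p] exceeds every exponent in the support, so exponents are digits in base [B] and [kap] is
   injective there. *)
pose B := msize p; pose kap (m : 'X_{1..n}) := (\sum_i m i * B ^ i)%N.
have mB m i : m \in msupp p -> (m i < B)%N.
  by move/msize_mdeg_lt; apply: leq_ltn_trans; rewrite mdegE (bigD1 i) // leq_addr.
have kap_inj m m' : m \in msupp p -> m' \in msupp p -> kap m = kap m' -> m = m'.
  move=> pm pm' E; apply/mnmP => i; apply: (digits_inj (B := B)) E i => i; exact: mB.
pose U : {poly K} := \sum_(m <- msupp p) p@_m *: 'X^(kap m).
have UE z : U.[z] = p.@[fun i => z ^+ (B ^ i)%N].
  rewrite mevalE horner_sum; apply: eq_bigr => m _.
  rewrite hornerZ hornerXn; congr (_ * _).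
  by under eq_bigr do rewrite -exprM mulnC; rewrite prodrXr.
(* By injectivity of [kap], no two monomials of [p] merge in [U]. *)
have Uc m : m \in msupp p -> U`_(kap m) = p@_m.
  move=> pm; rewrite coef_sum (bigD1_seq m) ?msupp_uniq //= coefZ coefXn eqxx mulr1.
  rewrite big_seq_cond big1 ?addr0 // => m' /andP[pm' m'm].
  rewrite coefZ coefXn; case: eqP => [/(kap_inj _ _ pm pm') E|]; last by rewrite mulr0.
  by rewrite E eqxx in m'm.
have [|d Ud] := @poly_monomial U.
  by move=> z z0; rewrite UE nz // => i; rewrite expf_neq0.
have kapd m : m \in msupp p -> kap m = d.
  move=> pm; apply/eqP; apply: contraTT pm => /Ud; rewrite mcoeff_msupp.
  case: (boolP (m \in msupp p)) => [pm|]; first by rewrite Uc // => ->; rewrite eqxx.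
  by rewrite mcoeff_msupp.
have pm := mlead_supp p0; exists (mlead p); first by rewrite -mcoeff_msupp.
move=> m' m'm; apply/eqP; apply: contraNT m'm; rewrite -mcoeff_msupp => pm'.
by apply/eqP/kap_inj => //; rewrite !kapd.
Qed.

End NonvanishingPolynomials.

(** * Closure properties of regular functions, density and irreducibility *)

Section RegularMaps.
Variable K : closedFieldType.

Lemma pair_point_subproof r m (S : algSet K r) (X : algSet K m) (s : S) (x : X) :
  prod_points S X (row_mx (val s) (val x)).
Proof. by split; rewrite ?row_mxKl ?row_mxKr; apply: set_valP. Qed.

Definition pair_point r m (S : algSet K r) (X : algSet K m) (s : S) (x : X) :
  prodA S X := SigSub (mem_set (pair_point_subproof s x)).

Lemma prod_fst_pair r m (S : algSet K r) (X : algSet K m) (s : S) (x : X) :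
  prod_fst (pair_point s x) = s.
Proof. by apply: val_inj; rewrite /= row_mxKl. Qed.

Lemma prod_snd_pair r m (S : algSet K r) (X : algSet K m) (s : S) (x : X) :
  prod_snd (pair_point s x) = x.
Proof. by apply: val_inj; rewrite /= row_mxKr. Qed.

Lemma regular_meval n (X : algSet K n) k (p : {mpoly K[k]}) (g : 'I_k -> X -> K) :
  (forall i, regular (g i)) -> regular (fun x => p.@[fun i => g i x]).
Proof.
move=> /choice[lp lpE]; exists (p \mPo [tuple lp i | i < k]) => x.
rewrite /peval comp_mpoly_meval; apply: meval_eq => i.
by rewrite tnth_map tnth_ord_tuple lpE.
Qed.

Lemma regular_comp n m (X : algSet K n) (Y : algSet K m) (f : X -> Y) (g : Y -> K) :
  regular_map f -> regular g -> regular (fun x => g (f x)).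
Proof.
move=> fR [p gp]; have [q qE] := regular_meval p fR.
by exists q => x; rewrite gp -qE.
Qed.

Lemma regular_map_comp n m k (X : algSet K n) (Y : algSet K m) (Z : algSet K k)
    (f : X -> Y) (g : Y -> Z) :
  regular_map f -> regular_map g -> regular_map (fun x => g (f x)).
Proof. by move=> fR gR j; apply: (regular_comp fR (gR j)). Qed.

Lemma regular_map_pair n r m (X : algSet K n) (S : algSet K r) (Y : algSet K m)
    (f : X -> S) (g : X -> Y) :
  regular_map f -> regular_map g -> regular_map (fun x => pair_point (f x) (g x)).
Proof.
move=> fR gR j; case: (split_ordP j) => i ->.
  by have [p pE] := fR i; exists p => x; rewrite -pE /Defs.coord /= row_mxEl.
by have [p pE] := gR i; exists p => x; rewrite -pE /Defs.coord /= row_mxEr.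
Qed.

Lemma regular_map_fst r m (S : algSet K r) (X : algSet K m) :
  regular_map (fun z : prodA S X => prod_fst z).
Proof. by move=> j; exists 'X_(lshift m j) => z; rewrite /peval mevalXU /Defs.coord /= mxE. Qed.

Lemma regular_map_snd r m (S : algSet K r) (X : algSet K m) :
  regular_map (fun z : prodA S X => prod_snd z).
Proof. by move=> j; exists 'X_(rshift r j) => z; rewrite /peval mevalXU /Defs.coord /= mxE. Qed.

Lemma regular_map2_comp n r m k (Z : algSet K n) (S : algSet K r) (X : algSet K m)
    (Y : algSet K k) (phi : S -> X -> Y) (f : Z -> S) (g : Z -> X) :
  regular_map2 phi -> regular_map f -> regular_map g ->
  regular_map (fun z => phi (f z) (g z)).
Proof.
move=> phiR fR gR j.
have [p pE] := regular_map_comp (regular_map_pair fR gR) phiR j.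
by exists p => z; rewrite -pE prod_fst_pair prod_snd_pair.
Qed.

Lemma regularM n (X : algSet K n) (f g : X -> K) :
  regular f -> regular g -> regular (fun x => f x * g x).
Proof. by move=> [p pE] [q qE]; exists (p * q) => x; rewrite /peval mevalM pE qE. Qed.

Lemma regularB n (X : algSet K n) (f g : X -> K) :
  regular f -> regular g -> regular (fun x => f x - g x).
Proof. by move=> [p pE] [q qE]; exists (p - q) => x; rewrite /peval mevalB pE qE. Qed.

Lemma regular_const n (X : algSet K n) c : regular (fun _ : X => c).
Proof. by exists c%:MP => x; rewrite /peval mevalC. Qed.

Lemma regular_exp n (X : algSet K n) (f : X -> K) e :
  regular f -> regular (fun x => f x ^+ e).
Proof. by move=> [p pE]; exists (p ^+ e) => x; rewrite /peval rmorphXn pE. Qed.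

Lemma regular_prod n (X : algSet K n) k (f : 'I_k -> X -> K) :
  (forall i, regular (f i)) -> regular (fun x => \prod_i f i x).
Proof.
move=> /choice[p pE]; exists (\prod_i p i) => x.
by rewrite /peval rmorph_prod; apply: eq_bigr => i _; rewrite pE.
Qed.

(** A negative power of [f] is a positive power of its regular inverse [g]. *)
Lemma regular_expz n (X : algSet K n) (f g : X -> K) (e : int) :
  regular f -> regular g -> (forall x, f x * g x = 1) -> regular (fun x => f x ^ e).
Proof.
move=> fR gR fg; have gE x : g x = (f x)^-1.
  have fx0 : f x != 0 by apply: contraTneq (oner_neq0 K) => fx0; rewrite -(fg x) fx0 mul0r eqxx.
  by apply: (mulfI fx0); rewrite fg divff.
case: e => e; first exact: regular_exp.
have [p pE] := regular_exp e.+1 gR.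
by exists p => x; rewrite -pE gE exprVn.
Qed.

Lemma dense_vanish n (X : algSet K n) (U : set 'rV[K]_n) (f : X -> K) :
  dense_in X U -> regular f -> (forall x, U (val x) -> f x = 0) -> forall x, f x = 0.
Proof.
move=> [UX UZ] [p fp] f0 x.
pose Z : algSet K n := AlgSet (ex_intro _ [set p] (erefl (zeros [set p]))).
rewrite fp; apply: (UZ Z _ _ (set_valP x)) => // y Uy _ ->.
by have := f0 (SigSub (mem_set (UX _ Uy))) Uy; rewrite fp.
Qed.

Lemma irreducible_mul0 n (X : algSet K n) (f g : X -> K) : irreducible X ->
  regular f -> regular g -> (forall x, f x * g x = 0) ->
  (forall x, f x = 0) \/ (forall x, g x = 0).
Proof.
move=> [_ irr] [p fp] [q gq] fg.
pose Z (p : {mpoly K[n]}) : algSet K n :=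
  AlgSet (ex_intro _ [set p] (erefl (zeros [set p]))).
have [x Xx||] := irr (Z p) (Z q).
- have := fg (SigSub (mem_set Xx)); rewrite fp gq /= => /eqP.
  by rewrite mulf_eq0 => /orP[]/eqP E; [left | right] => _ ->.
- by move=> XZ; left=> x; rewrite fp; apply: (XZ _ (set_valP x)).
- by move=> XZ; right=> x; rewrite gq; apply: (XZ _ (set_valP x)).
Qed.

End RegularMaps.

(** * Characters and cocharacters of the torus *)

Section TorusCharacters.
Variables (K : closedFieldType) (n : nat).

Definition torus_coord (t : torus K n) (i : 'I_n) : K := val t 0 (lshift n i).

Definition chi (u : 'I_n -> int) (t : torus K n) : K :=
  \prod_i torus_coord t i ^ u i.

Lemma torus_of_subproof (z : 'I_n -> K) : (forall i, z i != 0) ->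
  torus_points (row_mx (\row_i z i) (\row_i (z i)^-1)).
Proof. by move=> z0 i; rewrite row_mxEl row_mxEr !mxE divff. Qed.

Definition torus_of (z : 'I_n -> K) (z0 : forall i, z i != 0) : torus K n :=
  SigSub (mem_set (torus_of_subproof z0)).

Lemma torus_coord_of z z0 i : torus_coord (@torus_of z z0) i = z i.
Proof. by rewrite /torus_coord /= row_mxEl mxE. Qed.

Lemma torus_coord_neq0 (t : torus K n) i : torus_coord t i != 0.
Proof.
apply: contraTneq (oner_neq0 K) => t0.
by rewrite -(set_valP t i) -/(torus_coord t i) t0 mul0r eqxx.
Qed.

Lemma torus_inv_coord (t : torus K n) i : val t 0 (rshift n i) = (torus_coord t i)^-1.
Proof.
apply: (mulfI (torus_coord_neq0 t i)); rewrite divff ?torus_coord_neq0 //.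
exact: (set_valP t i).
Qed.

Lemma torus_ext (s t : torus K n) : torus_coord s =1 torus_coord t -> s = t.
Proof.
move=> st; apply/val_inj/rowP => j; case: (split_ordP j) => i ->.
  exact: st.
by rewrite !torus_inv_coord st.
Qed.

Lemma torus_coordM (s t : torus K n) i :
  torus_coord (torus_mul s t) i = torus_coord s i * torus_coord t i.
Proof. by rewrite /torus_coord /= mxE. Qed.

Lemma torus_coord1 i : torus_coord (torus_one K n) i = 1.
Proof. by rewrite /torus_coord /= mxE. Qed.

Lemma chi_neq0 u t : chi u t != 0.
Proof. by apply/prodf_neq0 => i _; rewrite expfz_neq0 // torus_coord_neq0. Qed.

Lemma chiM u s t : chi u (torus_mul s t) = chi u s * chi u t.
Proof. by rewrite -big_split; apply: eq_bigr => i _; rewrite torus_coordM expfzMl. Qed.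

Lemma chi1 u : chi u (torus_one K n) = 1.
Proof. by rewrite /chi big1 // => i _; rewrite torus_coord1 exp1rz. Qed.

(** The value at [z] of the cocharacter with weights [lam]. *)
Definition one_param (lam : 'I_n -> int) (z : K) (z0 : z != 0) : torus K n :=
  torus_of (fun i => expfz_neq0 (lam i) z0).

Lemma chi_one_param u lam z (z0 : z != 0) :
  chi u (one_param lam z0) = z ^ (\sum_i lam i * u i).
Proof.
rewrite /chi; under eq_bigr do rewrite torus_coord_of exprz_exp.
by elim/big_rec2: _ => [|i x y _ ->]; rewrite ?expr0z // expfzDr.
Qed.

Lemma chiX u k t : chi u t ^+ k = chi (fun i => k%:Z * u i) t.
Proof. by rewrite -prodrXl; apply: eq_bigr => i _; rewrite mulrC -exprz_exp. Qed.

End TorusCharacters.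

(** * Units on the product of an irreducible variety and a torus *)

Section UnitsOfFamilies.
Variables (K : closedFieldType) (r n : nat).
Implicit Types (q : {mpoly {mpoly K[r]}[n]}) (s : 'rV[K]_r) (t : torus K n).

Definition specialize s q : {mpoly K[n]} := map_mpoly (meval (fun i => s 0 i)) q.

(** Laurent polynomials in [t] with coefficients polynomial in [s]. A common denominator, a power of
    the product of all torus coordinates, keeps the numerator in a polynomial ring. *)
Definition laurent_in (F : 'rV[K]_r -> torus K n -> K) : Prop :=
  exists N q, forall s t,
    (\prod_i torus_coord t i) ^+ N * F s t = (specialize s q).@[torus_coord t].

Lemma laurent_in_const c : laurent_in (fun _ _ => c).
Proof.
by exists 0%N, (c%:MP)%:MP => s t; rewrite expr0 mul1r /specialize map_mpolyC mevalC /= mevalC.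
Qed.

Let meval_prodX s t N :
  (specialize s (\prod_i 'X_i ^+ N)).@[torus_coord t] = (\prod_i torus_coord t i) ^+ N.
Proof.
rewrite /specialize !rmorph_prod -prodrXl; apply: eq_bigr => i _.
by rewrite !rmorphXn /= map_mpolyX mevalXU.
Qed.

Lemma laurent_inD F G : laurent_in F -> laurent_in G ->
  laurent_in (fun s t => F s t + G s t).
Proof.
move=> [M [p pE]] [N [q qE]].
exists (M + N)%N, (p * (\prod_i 'X_i ^+ N) + q * (\prod_i 'X_i ^+ M)) => s t.
rewrite /specialize !rmorphD !rmorphM /= -!/(specialize _ _) !meval_prodX -pE -qE.
by rewrite exprD mulrDr; congr (_ + _); [rewrite mulrAC | rewrite -mulrA mulrC].
Qed.

Lemma laurent_inM F G : laurent_in F -> laurent_in G ->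
  laurent_in (fun s t => F s t * G s t).
Proof.
move=> [M [p pE]] [N [q qE]]; exists (M + N)%N, (p * q) => s t.
by rewrite /specialize !rmorphM /= -!/(specialize _ _) -pE -qE exprD mulrACA.
Qed.

Lemma laurent_in_coord (j : 'I_(r + (n + n))) :
  laurent_in (fun s t => row_mx s (val t) 0 j).
Proof.
case: (split_ordP j) => {j} [i|j] ->.
  exists 0%N, ('X_i)%:MP => s t.
  by rewrite expr0 mul1r row_mxEl /specialize map_mpolyC mevalC /= mevalXU.
case: (split_ordP j) => {j} i ->.
  exists 0%N, 'X_i => s t.
  by rewrite expr0 mul1r row_mxEr /specialize map_mpolyX mevalXU.
(* This coordinate is the inverse of the [i]-th torus coordinate; the denominator cancels it and
   leaves the product of the others. *)
exists 1%N, (\prod_(k | k != i) 'X_k) => s t.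
rewrite row_mxEr torus_inv_coord (bigD1 i) //= mulrAC divff ?torus_coord_neq0 // mul1r.
rewrite /specialize !rmorph_prod; apply: eq_bigr => k _.
by rewrite /= map_mpolyX mevalXU.
Qed.

Lemma laurent_in_poly (p : {mpoly K[r + (n + n)]}) :
  laurent_in (fun s t => peval p (row_mx s (val t))).
Proof.
elim/mpolyind: p => [|c m p _ _ IHp].
  have [N [q qE]] := laurent_in_const 0.
  by exists N, q => s t; rewrite -qE /peval meval0.
suff Lm : laurent_in (fun s t => peval 'X_[m] (row_mx s (val t))).
  have [N [q qE]] := laurent_inD (laurent_inM (laurent_in_const c) Lm) IHp.
  by exists N, q => s t; rewrite -qE /peval mevalD mevalZ.
have LX i e : laurent_in (fun s t => row_mx s (val t) 0 i ^+ e).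
  elim: e => [|e IHe]; first exact: laurent_in_const.
  have [N [q qE]] := laurent_inM (laurent_in_coord i) IHe.
  by exists N, q => s t; rewrite -qE exprS.
have : laurent_in (fun s t =>
    \prod_(i <- index_enum 'I_(r + (n + n))) row_mx s (val t) 0 i ^+ m i).
  elim: (index_enum _) => [|i e IHe].
    have [N [q qE]] := laurent_in_const 1.
    by exists N, q => s t; rewrite -qE big_nil.
  have [N [q qE]] := laurent_inM (LX i (m i)) IHe.
  by exists N, q => s t; rewrite -qE big_cons.
by move=> [N [q qE]]; exists N, q => s t; rewrite -qE /peval mevalX.
Qed.

(* A special case of Rosenlicht's theorem on units of a product: each [F s] is
   a scalar times a character, so the coefficients of two distinct characters
   have product zero, and irreducibility of [S] leaves only one character. *)
Lemma units_of_family (S : affineVariety K r) (F : S -> torus K n -> K) :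
  regular (fun z : prodA S (torus K n) => F (prod_fst z) (prod_snd z)) ->
  (forall (s : S) t, F s t != 0) ->
  exists (v : 'I_n -> int) (a : S -> K), forall (s : S) t, F s t = a s * chi v t.
Proof.
move=> [p pE] F0; have [N [q qE]] := laurent_in_poly p.
have FE (s : S) t : (\prod_i torus_coord t i) ^+ N * F s t =
    (specialize (val s) q).@[torus_coord t].
  by rewrite -qE -(pE (pair_point s t)) prod_fst_pair prod_snd_pair.
have prod0 t : \prod_i torus_coord t i != 0.
  by apply/prodf_neq0 => i _; apply: torus_coord_neq0.
have mono (s : S) : exists2 m, peval q@_m (val s) != 0 &
    forall m', m' != m -> peval q@_m' (val s) = 0.
  have [|m] := @mpoly_monomial K n (specialize (val s) q).
    move=> z z0; rewrite (meval_eq _ (v2 := torus_coord (torus_of z0))).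
      by rewrite -FE mulf_neq0 // expf_neq0.
    by move=> i; rewrite torus_coord_of.
  rewrite mcoeff_map_mpoly => m0 mE; exists m => // m' /mE.
  by rewrite mcoeff_map_mpoly.
have [[s0 Ss0] _] := variety_irr S; pose s1 : S := SigSub (mem_set Ss0).
have [m m0 _] := mono s1.
(* At each point of [S] only one coefficient survives, so those of [m'] and [m] have product zero on
   [S]. The one of [m] is nonzero at [s1], so the other vanishes identically. *)
have cE m' (s : S) : m' != m -> peval q@_m' (val s) = 0.
  move=> m'm; have regc k : regular (fun s : S => peval q@_k (val s)) by exists q@_k.
  have [|H|H] := irreducible_mul0 (variety_irr S) (regc m') (regc m).
  - move=> s'; have [k _ kE] := mono s'; case: (eqVneq m' k) => [E|/kE ->].
      by rewrite [X in _ * X]kE ?mulr0 // -E eq_sym.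
    by rewrite mul0r.
  - exact: H.
  - by rewrite H eqxx in m0.
(* Subtracting [N] from each exponent accounts for the common denominator. *)
exists (fun i => (m i)%:Z - N%:Z), (fun s : S => peval q@_m (val s)) => s t.
apply: (mulfI (expf_neq0 N (prod0 t))); rewrite FE mulrCA.
have -> : specialize (val s) q = peval q@_m (val s) *: 'X_[m].
  apply/mpolyP => k; rewrite mcoeff_map_mpoly mcoeffZ mcoeffX.
  by case: (eqVneq m k) => [<-|mk]; rewrite ?mulr1 // mulr0; apply: cE; rewrite eq_sym.
rewrite mevalZ mevalX -prodrXl -big_split; congr (_ * _); apply: eq_bigr => i _.
by rewrite /= !exprnP -expfzDr ?torus_coord_neq0 // addrC subrK.
Qed.

End UnitsOfFamilies.

(** * Units and characters on a toric variety *)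

(** In characteristic zero 2 is not a root of unity, so the value of a cocharacter at 2 is enough to
    detect exponents. *)
Lemma exp2_eq1 (K : fieldType) (e : int) : [pchar K] =i pred0 ->
  (2%:R : K) ^ e = 1 -> e = 0.
Proof.
move=> charK0; have exp2 k : (2%:R : K) ^+ k = 1 -> k = 0%N.
  move/eqP; rewrite -natrX -subr_eq0 -(natrB _ (expn_gt0 2 k)).
  by rewrite ((pcharf0P K).1 charK0) subn_eq0 -[X in (_ <= X)%N](expn0 2) leq_exp2l // leqn0 => /eqP.
case: e => k /=; first by move/exp2 => ->.
by move/eqP; rewrite NegzE -exprnN invr_eq1 => /eqP/exp2.
Qed.

Section ToricVariety.
Variables (K : closedFieldType) (charK0 : [pchar K] =i pred0).
Variables (n m : nat) (X : affineToricVariety K n m).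

Let two0 : (2%:R : K) != 0.
Proof. by rewrite ((pcharf0P K).1 charK0). Qed.

(** The identity of the torus gives [a = b]; the [i]-th coordinate cocharacter at 2 then compares
    the [i]-th exponents. *)
Lemma chi_scalar_inj (a b : K) (u v : 'I_n -> int) : a != 0 ->
  (forall t : torus K n, a * chi u t = b * chi v t) -> u =1 v.
Proof.
move=> a0 uv i; have := uv (torus_one K n); rewrite !chi1 !mulr1 => ab.
have := uv (one_param (fun j => (j == i)%:R) two0).
rewrite -ab !chi_one_param => /(mulfI a0).
have delta (w : 'I_n -> int) : \sum_j (j == i)%:R * w j = w i.
  by rewrite (bigD1 i) //= eqxx mul1r big1 ?addr0 // => j /negPf ->; rewrite mul0r.
rewrite !delta => E; apply/eqP; rewrite -subr_eq0; apply/eqP.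
by apply: (@exp2_eq1 K); rewrite // expfzDr // E -expfzDr // subrr.
Qed.

Lemma emb_vanish (f : X -> K) : regular f ->
  (forall t, f (toric_emb X t) = 0) -> forall x, f x = 0.
Proof.
move=> fR f0; apply: (dense_vanish (toric_emb_dense X) fR) => x [t _ tx].
by rewrite -(f0 t); congr f; apply: val_inj.
Qed.

Lemma emb_regular : regular_map (toric_emb X).
Proof. by have [] := toric_emb_open X. Qed.

Lemma unit_on_torus (f g : X -> K) : regular f -> (forall x, f x * g x = 1) ->
  exists2 c : K, c != 0 & exists v, forall t, f (toric_emb X t) = c * chi v t.
Proof.
move=> fR fg; have f0 x : f x != 0.
  by apply: contraTneq (oner_neq0 K) => fx0; rewrite -(fg x) fx0 mul0r eqxx.
(* The family is constant: [X] itself serves as the irreducible base, and the parameter is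
   ignored. *)
have [|//|v [a av]] := @units_of_family K m n X (fun _ t => f (toric_emb X t)).
  exact: regular_comp (regular_map_comp (@regular_map_snd _ _ _ _ _) emb_regular) fR.
pose x0 := toric_emb X (torus_one K n).
exists (a x0); last by exists v => t; rewrite (av x0).
by have := f0 x0; rewrite (av x0) chi1 mulr1.
Qed.

(** The inverse of the open embedding is locally a quotient of polynomials; the quotient taken is
    the one around the identity. It makes torus coordinates rational functions on [X]. *)
Lemma torus_coord_fraction (j : 'I_(n + n)) : exists a b : X -> K,
  [/\ regular a, regular b, b (toric_emb X (torus_one K n)) != 0
    & forall t, b (toric_emb X t) != 0 ->
        a (toric_emb X t) = val t 0 j * b (toric_emb X t)].
Proof.
have [_ _ [g [gE gR]]] := toric_emb_open X.
have imt t : image_points (toric_emb X) (val (toric_emb X t)) by exists t.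
pose u t : image_points (toric_emb X) := SigSub (mem_set (imt t)).
have [a [b [b1 ab]]] := gR j (u (torus_one K n)).
exists (fun x => peval a (val x)), (fun x => peval b (val x)); split=> //.
- by exists a.
- by exists b.
move=> t bt; have := ab (u t) bt; rewrite (gE t) // /Defs.coord => ->.
by rewrite divfK.
Qed.

Lemma chi_fraction (v : 'I_n -> int) : exists a b : X -> K,
  [/\ regular a, regular b, b (toric_emb X (torus_one K n)) != 0
    & forall t, b (toric_emb X t) != 0 ->
        a (toric_emb X t) = chi v t * b (toric_emb X t)].
Proof.
have one i : exists ab : (X -> K) * (X -> K),
  [/\ regular ab.1, regular ab.2, ab.2 (toric_emb X (torus_one K n)) != 0
    & forall t, ab.2 (toric_emb X t) != 0 ->
        ab.1 (toric_emb X t) = torus_coord t i ^ v i * ab.2 (toric_emb X t)].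
  suff [j [e jE]] : exists j e, forall t : torus K n,
      val t 0 j ^+ e = torus_coord t i ^ v i.
    have [a [b [aR bR b1 ab]]] := torus_coord_fraction j.
    (* The extra factor [b x] ensures that a nonzero denominator forces [b x] to be nonzero, even
       for [e = 0]. *)
    exists (fun x => a x ^+ e * b x, fun x => b x ^+ e * b x); split=> /=.
    - by apply: regularM => //; apply: regular_exp.
    - by apply: regularM => //; apply: regular_exp.
    - by rewrite mulf_neq0 // expf_neq0.
    - move=> t; rewrite mulf_eq0 negb_or => /andP[_ /ab ->].
      by rewrite exprMn jE mulrA.
  case: (v i) => e; first by exists (lshift n i), e.
  by exists (rshift n i), e.+1 => t; rewrite torus_inv_coord exprVn.
have [ab abP] := choice one.
exists (fun x => \prod_i (ab i).1 x), (fun x => \prod_i (ab i).2 x); split.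
- by apply: regular_prod => i; case: (abP i).
- by apply: regular_prod => i; case: (abP i).
- by apply/prodf_neq0 => i _; case: (abP i).
move=> t /prodf_neq0 bt; rewrite -big_split; apply: eq_bigr => i _.
by case: (abP i) => _ _ _ -> //; apply: bt.
Qed.

Definition regfun_of (f : X -> K) (fR : regular f) : regfun X :=
  @RegFun K m X f (asboolT fR).

Lemma regfunX (f : regfun X) k x : (f ^+ k) x = f x ^+ k.
Proof. by elim: k => [|k IHk] //; rewrite !exprS regfunM IHk. Qed.

(* The character [chi v] is a root of the unit [f / c] in the fraction field,
   hence regular by normality. *)
Lemma unit_root (f g : X -> K) (c : K) (k : nat) (v : 'I_n -> int) :
  regular f -> regular g -> (forall x, f x * g x = 1) -> c != 0 -> (0 < k)%N ->
  (forall t, f (toric_emb X t) = c * chi (fun i => k%:Z * v i) t) ->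
  exists h h' : X -> K, [/\ regular h, regular h', forall x, h x * h' x = 1
    & forall t, h (toric_emb X t) = chi v t].
Proof.
move=> fR gR fg c0 k0 fE; have [a [b [aR bR b1 ab]]] := chi_fraction v.
have fcR : regular (fun x => c^-1 * f x) by apply: regularM => //; apply: regular_const.
(* On the torus the identity is known only where [b] is nonzero. Multiplied by [b] it holds on the
   whole torus, hence on [X] by density, and irreducibility cancels [b]. *)
have akE x : a x ^+ k = c^-1 * f x * b x ^+ k.
  have [||E|E] := irreducible_mul0 (variety_irr X)
      (f := fun x => a x ^+ k - c^-1 * f x * b x ^+ k) (g := b) _ bR.
  - apply: regularB; [exact: regular_exp | apply: regularM => //; exact: regular_exp].
  - apply: emb_vanish => [|t].
      apply: regularM => //; apply: regularB; first exact: regular_exp.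
      by apply: regularM => //; apply: regular_exp.
    have [->|bt] := eqVneq (b (toric_emb X t)) 0; first by rewrite mulr0.
    by rewrite ab // fE mulKf // exprMn chiX subrr mul0r.
  - by apply/eqP; rewrite -subr_eq0 E.
  - by rewrite E eqxx in b1.
pose A := regfun_of aR; pose B := regfun_of bR; pose F := regfun_of fcR.
have B0 : tofrac B != 0.
  rewrite tofrac_eq0; apply: contraNneq b1 => B0.
  by rewrite -[b _]/(B _) B0.
have AB : tofrac A ^+ k = tofrac F * tofrac B ^+ k.
  rewrite -!tofracXn -tofracM; congr tofrac; apply/val_inj/funext => x.
  by rewrite /= regfunX akE -[RHS]/(F x * (B ^+ k) x) regfunX.
have [|h hE] := @toric_normal K n m X (tofrac A / tofrac B).
  (* The fraction is a root of this monic polynomial, hence integral over the coordinate ring. *)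
  exists ('X^k - F%:P); first by rewrite monicXnsubC.
  rewrite rmorphB /= map_polyXn map_polyC /= /root !hornerE.
  by rewrite expr_div_n AB mulfK ?expf_neq0 // subrr.
have hk x : h x ^+ k = c^-1 * f x.
  rewrite -regfunX; suff -> : h ^+ k = F by [].
  apply/eqP; rewrite -tofrac_eq tofracXn -hE expr_div_n AB mulfK ?expf_neq0 //.
have hR : regular h by have [p pE] := regfunP h; exists p.
have hh' x : h x * (h x ^+ k.-1 * (c * g x)) = 1.
  by rewrite mulrA -exprS prednK // hk mulrACA fg mulr1 mulVf.
have [d d0 [w hw]] := unit_on_torus hR hh'.
(* The [k]-th power of [h] is [f / c], which on the torus is both the character of weight [k v] and
   [d ^+ k] times that of weight [k w]. *)
have vw : v =1 w.
  have k0' : k%:Z != 0 by rewrite -lt0n.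
  move=> i; apply: (mulfI k0').
  apply: (chi_scalar_inj (a := 1) (b := d ^+ k) (oner_neq0 K)
    (u := fun i => k%:Z * v i) (v := fun i => k%:Z * w i)) => t.
  rewrite mul1r -[in RHS]chiX -exprMn -hw hk fE mulKf //.
exists (fun x => d^-1 * h x), (fun x => d * (h x ^+ k.-1 * (c * g x))); split.
- by apply: regularM => //; apply: regular_const.
- apply: regularM; first exact: regular_const.
  apply: regularM; first exact: regular_exp.
  by apply: regularM => //; apply: regular_const.
- by move=> x; rewrite mulrACA mulVf // mul1r hh'.
- move=> t; rewrite hw mulKf //; apply: eq_bigr => i _; by rewrite vw.
Qed.

End ToricVariety.

Lemma degenerate_character (K : closedFieldType) (charK0 : [pchar K] =i pred0)
    (n m : nat) (X : affineToricVariety K n m) : degenerate X ->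
  exists (u lam : 'I_n -> int) (h h' : X -> K),
    [/\ \sum_i lam i * u i = 1, regular h, regular h', forall x, h x * h' x = 1
      & forall t, h (toric_emb X t) = chi u t].
Proof.
move=> /existsNP[f /not_implyP[fU fc]].
pose g := f^-1; have fg x : f x * g x = 1 by rewrite -regfunM divrr.
have fR : regular f by have [p pE] := regfunP f; exists p.
have gR : regular g by have [p pE] := regfunP g; exists p.
have [c c0 [w fw]] := unit_on_torus fR fg.
have [|k [lam [u [k0 wE lamu]]]] := @bezout_int n w.
  (* If all weights vanished, [f] would equal [c] on the dense torus, hence on [X]. *)
  apply: contrapT => w0; apply: fc; exists c => x; apply/eqP; rewrite -subr_eq0.
  apply/eqP; move: x; apply: (@emb_vanish K n m X (fun x => f x - c)).
    by apply: regularB => //; apply: regular_const.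
  move=> t; rewrite fw /chi big1 ?mulr1 ?subrr // => i _.
  by have [->//|wi] := eqVneq (w i) 0; case: w0; exists i.
have fE t : f (toric_emb X t) = c * chi (fun i => k%:Z * u i) t.
  by rewrite fw; congr (_ * _); apply: eq_bigr => i _; rewrite wE.
have [h [h' [hR hR' hh' hE]]] := unit_root charK0 fR gR fg c0 k0 fE.
by exists u, lam, h, h'.
Qed.

(** * The involution inverting a character *)

Section Reflection.
Variables (K : closedFieldType) (n m : nat) (X : affineToricVariety K n m).
Variables (u lam : 'I_n -> int) (h h' : X -> K).
Hypotheses (lamu : \sum_i lam i * u i = 1) (hR : regular h) (hR' : regular h').
Hypotheses (hh' : forall x, h x * h' x = 1).
Hypothesis hE : forall t, h (toric_emb X t) = chi u t.

Lemma unit_neq0 x : h x != 0.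
Proof. by apply: contraTneq (oner_neq0 K) => hx0; rewrite -(hh' x) hx0 mul0r eqxx. Qed.

(** The cocharacter [lam] at the inverse square of [h x]. As [lam] pairs to 1 with [u], acting by it
    multiplies [h x] by [h x ^ (- 2)]. *)
Definition reflection_param (x : X) : torus K n :=
  one_param (fun i => - 2 * lam i) (unit_neq0 x).

(* On characters this is the reflection [v |-> v - 2 <lam, v> u], which sends
   [u] to [- u]. *)
Definition reflection (x : X) : X := toric_act (reflection_param x) x.

Lemma reflection_regular : regular_map reflection.
Proof.
apply: (regular_map2_comp (@toric_act_regular _ _ _ X)); last first.
  by move=> j; exists 'X_j => x; rewrite /peval mevalXU.
have powR e : regular (fun x => h x ^ e) by apply: (regular_expz _ hR hR').
move=> j; case: (split_ordP j) => i ->.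
  have [p pE] := powR (- 2 * lam i); exists p => x.
  by rewrite -pE; apply: torus_coord_of.
(* The second half of a torus point holds the inverse coordinates, whence the opposite exponent. *)
have [p pE] := powR (- (- 2 * lam i)); exists p => x.
by rewrite -pE /Defs.coord torus_inv_coord torus_coord_of invr_expz.
Qed.

Lemma reflection_unit x : h (reflection x) * h x = 1.
Proof.
apply/eqP; rewrite -subr_eq0; apply/eqP; move: x.
apply: (emb_vanish (f := fun x => h (reflection x) * h x - 1)) => [|t].
  apply: regularB; last exact: regular_const.
  by apply: regularM => //; apply: regular_comp reflection_regular hR.
rewrite /reflection toric_act_emb !hE chiM chi_one_param hE.
under eq_bigr do rewrite -mulrA.
rewrite -mulr_sumr lamu mulr1 -mulrA -expr2 exprnP -expfzDr ?chi_neq0 //.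
by rewrite addNr subrr.
Qed.

(** Since [h] takes inverse values at a point and at its image, the torus elements acting there are
    inverse to each other. *)
Lemma reflectionK : involutive reflection.
Proof.
move=> x; rewrite [LHS]/reflection {2}/reflection -toric_actM -[RHS]toric_act1.
congr toric_act; apply: torus_ext => i.
rewrite torus_coordM !torus_coord_of torus_coord1 -expfzMl.
by rewrite reflection_unit exp1rz.
Qed.

Lemma reflection_automorphism : automorphism reflection.
Proof.
split; first exact: reflection_regular.
exists reflection; split; [exact: reflection_regular | |]; exact: reflectionK.
Qed.

End Reflection.

(** * The reflection and the identity share no algebraic family *)

Theorem proposition1 (K : closedFieldType) (charK0 : [pchar K] =i pred0)
    (n m : nat) (X : affineToricVariety K n m) (degX : degenerate X) :
  ~ Aut_connected X.
Proof.
move=> conn.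
have [u [lam [h [h' [lamu hR hR' hh' hE]]]]] := degenerate_character charK0 degX.
have [r [S [phi [[_ phiR] [s0 phi0] [s1 phi1]]]]] :=
  conn _ (reflection_automorphism lamu hR hR' hh' hE).
have [||v [a av]] := @units_of_family K r n S (fun s t => h (phi s (toric_emb X t))).
- apply: regular_comp hR; apply: (regular_map2_comp phiR).
    exact: regular_map_fst.
  exact: regular_map_comp (@regular_map_snd _ _ _ _ _) (emb_regular X).
- by move=> s t; apply: unit_neq0.
(* At [s0], the reflection, [a s0 * chi v t] is the inverse of [chi u t]; at [s1], the identity,
   [a s1 * chi v t] is [chi u t]. Eliminate [chi v t]. *)
have square t : a s0 * chi u t ^+ 2 = a s1.
  apply: (mulIf (chi_neq0 v t)); rewrite -av phi1 hE.
  rewrite mulrAC -av phi0 expr2 mulrA -hE.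
  by rewrite (reflection_unit lamu hR hR' hh' hE) mul1r.
have two0 : (2%:R : K) != 0 by rewrite ((pcharf0P K).1 charK0).
have a0 : a s0 != 0.
  have := @unit_neq0 _ _ _ _ _ _ hh' (phi s0 (toric_emb X (torus_one K n))).
  by rewrite av mulf_eq0 negb_or => /andP[].
(* The square of [chi u] is thus constant on the torus, but it is 1 at the identity and 4 at the
   value of the cocharacter [lam] at 2. *)
have := square (torus_one K n); rewrite -(square (one_param lam two0)).
move=> /(mulfI a0); rewrite chi1 chi_one_param lamu expr1n expr1z => /esym.
by move/(exp2_eq1 (e := 2) charK0).
Qed.
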